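(* Let $n\ge 4$ be an integer. Then the toric ideal $I_{K_n}$ of the complete graph $K_n$ on $n$ vertices has a minimal splitting if and only if $4\le n\le 5$.
   Context: Let $K$ be any field. For a finite simple graph $G$ with vertices $v_1,\dots,v_p$ and edge set $E(G)=\{e_1,\dots,e_q\}$, the edges are also used as variables of the polynomial ring $K[e_1,\dots,e_q]$, and the toric ideal $I_G\subset K[e_1,\dots,e_q]$ is the kernel of the $K$-algebra map $K[e_1,\dots,e_q]\to K[v_1,\dots,v_p]$ sending an edge $e=\{v_i,v_j\}$ to $v_iv_j$. For a subgraph $H$ of $G$ (not necessarily connected), $I_H$ is defined in the same way in the variables $E(H)$ and is regarded as the ideal it generates in $K[e_1,\dots,e_q]$. A subgraph splitting of $I_G$ is an equality $I_G=I_{G_1}+I_{G_2}$ with $G_1,G_2$ subgraphs of $G$, $I_{G_1}\neq I_G$ and $I_{G_2}\neq I_G$. A minimal system of binomial generators of such an ideal is an inclusion-minimal generating set consisting of binomials (differences of two monomials). Let $I_G=I_{G_1}+I_{G_2}$ be a subgraph splitting, let $\{f_1,\dots,f_r\}$ be a minimal system of binomial generators of $I_{G_1}$ and $\{g_1,\dots,g_t\}$ a minimal system of binomial generators of $I_{G_2}$ (with $r$, $t$ elements respectively). The splitting is a minimal splitting of $I_G$ if $f_1,\dots,f_r,g_1,\dots,g_t$ are $r+t$ distinct elements forming a minimal system of generators of $I_G$; this property does not depend on the chosen minimal systems of generators of $I_{G_1}$ and $I_{G_2}$. $K_n$ is the graph with $n$ vertices in which every two distinct vertices are joined by an edge. 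*)

(* Defs.v *)
From HB Require Import structures.
From mathcomp Require Import all_boot all_order all_algebra.
From mathcomp Require Import mpoly.

Set Implicit Arguments.
Unset Strict Implicit.
Unset Printing Implicit Defensive.

Import GRing.Theory.
Local Open Scope ring_scope.

Section Ideals.

Variable R : comNzRingType.
Implicit Types (I J S : R -> Prop) (fs gs : seq R).

Definition ideal_eq I J := forall x, I x <-> J x.

Definition ideal_add I J : R -> Prop :=
  fun x => exists a b, [/\ I a, J b & x = a + b].

Definition ideal_gen S : R -> Prop :=
  fun x => exists2 s : seq (R * R),
    (forall c, c \in s -> S c.2) & x = \sum_(c <- s) c.1 * c.2.

Definition generates fs I := ideal_eq (ideal_gen (fun f => f \in fs)) I.

Definition minimal_generators fs I :=
  [/\ uniq fs,
      generates fs I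
    & forall gs, {subset gs <= fs} -> generates gs I -> {subset fs <= gs}].

End Ideals.

Definition binomial_mpoly (K : fieldType) (q : nat) (f : {mpoly K[q]}) :=
  exists u v : 'X_{1..q}, f = 'X_[u] - 'X_[v].

Definition minimal_binomial_generators (K : fieldType) (q : nat)
    (fs : seq {mpoly K[q]}) (I : {mpoly K[q]} -> Prop) :=
  minimal_generators fs I /\ forall f, f \in fs -> binomial_mpoly f.

(* Finite simple graphs with vertices in an ambient finite type, so that a
   graph and its subgraphs have the same Rocq type. An edge is the set of its
   two end points. *)
Record graph (T : finType) := Graph {
  verts : {set T};
  edges : {set {set T}};
  edgesP : [forall e in edges, (#|e| == 2%N) && (e \subset verts)]
}.

Definition subgraph (T : finType) (H G : graph T) : bool :=
  (verts H \subset verts G) && (edges H \subset edges G).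

Lemma subgraph_edges (T : finType) (H G : graph T) :
  subgraph H G -> {subset edges H <= edges G}.
Proof. by case/andP=> _ /subsetP. Qed.

Lemma complete_edgesP (n : nat) :
  [forall e in [set e : {set 'I_n} | #|e| == 2%N],
     (#|e| == 2%N) && (e \subset [set: 'I_n])].
Proof. by apply/forall_inP=> e; rewrite inE subsetT andbT. Qed.

Definition complete_graph (n : nat) : graph 'I_n := Graph (complete_edgesP n).

Section ToricIdeals.

Variables (K : fieldType) (T : finType).
Implicit Types G H : graph T.

(* The variable 'X_i of {mpoly K[#|edges G|]} stands for the edge enum_val i,
   and the variable 'X_j of {mpoly K[#|verts G|]} for the vertex enum_val j. *)
Definition edge_monomial G (i : 'I_#|edges G|) : {mpoly K[#|verts G|]} :=
  \prod_(j < #|verts G| | enum_val j \in enum_val i) 'X_j.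

Definition toric_map G (f : {mpoly K[#|edges G|]}) : {mpoly K[#|verts G|]} :=
  f \mPo [tuple edge_monomial i | i < #|edges G|].

Definition toric_ideal G : {mpoly K[#|edges G|]} -> Prop :=
  fun f => toric_map f = 0.

(* The index, among the edges of G, of the i-th edge of the subgraph H. *)
Definition edge_index H G (sHG : subgraph H G) (i : 'I_#|edges H|) :
    'I_#|edges G| :=
  enum_rank_in (subgraph_edges sHG (enum_valP i)) (enum_val i).

Definition edge_ring_incl H G (sHG : subgraph H G) (f : {mpoly K[#|edges H|]}) :
    {mpoly K[#|edges G|]} :=
  f \mPo [tuple 'X_(edge_index sHG i) | i < #|edges H|].

Definition subgraph_ideal H G (sHG : subgraph H G) :
    {mpoly K[#|edges G|]} -> Prop :=
  ideal_gen (fun f => exists2 h, toric_ideal h & f = edge_ring_incl sHG h).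

Definition subgraph_splitting G G1 G2
    (s1 : subgraph G1 G) (s2 : subgraph G2 G) :=
  [/\ ideal_eq (@toric_ideal G)
        (ideal_add (subgraph_ideal s1) (subgraph_ideal s2)),
      ~ ideal_eq (subgraph_ideal s1) (@toric_ideal G)
    & ~ ideal_eq (subgraph_ideal s2) (@toric_ideal G)].

(* All minimal systems of binomial generators of a toric ideal consist of
   homogeneous elements, hence have the same size; so the condition below does
   not depend on the choice of fs and gs. *)
Definition minimal_splitting G G1 G2
    (s1 : subgraph G1 G) (s2 : subgraph G2 G) :=
  subgraph_splitting s1 s2 /\
  exists fs gs : seq {mpoly K[#|edges G|]},
    [/\ minimal_binomial_generators fs (subgraph_ideal s1),
        minimal_binomial_generators gs (subgraph_ideal s2)
      & minimal_generators (fs ++ gs) (@toric_ideal G)].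

Definition has_minimal_splitting G :=
  exists (G1 G2 : graph T) (s1 : subgraph G1 G) (s2 : subgraph G2 G),
    minimal_splitting s1 s2.

End ToricIdeals.

(* Main.v *)
Require Import Defs.
From mathcomp Require Import all_boot all_order all_algebra.
From mathcomp Require Import mpoly.
From mathcomp Require Import zify ring.

Set Implicit Arguments.
Unset Strict Implicit.
Unset Printing Implicit Defensive.

Import GRing.Theory.
Local Open Scope ring_scope.

(** Write [N1] and [N2] for the edges of K_n missing from the two subgraphs
    of a splitting.  Everything is decided in degree two, inside the sets of
    four vertices: four vertices carry three perfect matchings, their three
    monomials have the same image, and all other fibres of degree at most two
    are singletons.

    For [n >= 6] three facts about a minimal splitting contradict each other.
    No generator has degree below two, so a monomial of degree two that is
    available in neither subgraph occurs in no element of the sum of the two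
    ideals: for disjoint edges [e] and [f], one subgraph contains both
    ([splitting_pairing]).  A 4-cycle in both subgraphs would give a quadratic
    binomial in both ideals; written in the two minimal systems, its degree two
    part makes one quadratic generator a combination of the others
    ([quadratic_common_eq0], a graded Nakayama argument), so there is no such
    cycle ([minimal_splitting_cycle]).  Finally [N1] and [N2] are not empty.
    By the first fact, an edge of [N1] and an edge of [N2] share exactly one
    vertex, say they are [xy] and [xz]; three further vertices then force at
    least two edges of [N1] from [z] to them and at least two edges of [N2]
    from [y] to them, and two of those are disjoint.

    For [n = 4] and [n = 5] take [N1 = {01, 23}] and [N2 = {02, 13}].  To see
    that a family of quadratic binomials generates the ideal of such a graph,
    the vertices are put on a circle in an order that makes the two missing
    edges sides of the polygon.  Replacing two disjoint non-crossing chords by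
    the crossing pair on the same four ends is then always possible inside the
    graph, it terminates because it decreases a convex weight, and a pairwise
    crossing multiset of chords is determined by its vertex degrees: the lower
    ends are the first half of the sorted list of all ends, the upper ends the
    second half ([word_monomial_congr]).  The cyclic orders [0,1,2,3,4] and
    [0,2,1,3,4] serve [N1] and [N2], and the first also serves K_n.  Each of the
    resulting generators has a monomial that no other generator contains,
    namely the one using an edge missing from the other subgraph, so all the
    families are minimal ([dual_monomials_minimal]). *)

(** * Ideals generated by a set *)

Section IdealGen.

Variable R : comNzRingType.
Implicit Types (S : R -> Prop) (fs gs : seq R).

Lemma ideal_gen0 S : ideal_gen S 0.
Proof. by exists [::]; rewrite ?big_nil. Qed.

Lemma ideal_genD S x y : ideal_gen S x -> ideal_gen S y -> ideal_gen S (x + y).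
Proof.
move=> [s Ss ->] [t St ->]; exists (s ++ t); last by rewrite big_cat.
by move=> c; rewrite mem_cat => /orP[/Ss|/St].
Qed.

Lemma ideal_genM S a x : ideal_gen S x -> ideal_gen S (a * x).
Proof.
move=> [s Ss ->]; exists [seq (a * c.1, c.2) | c <- s].
  by move=> c /mapP[d /Ss Sd ->].
by rewrite big_map mulr_sumr; apply: eq_bigr => c _; rewrite mulrA.
Qed.

Lemma ideal_genN S x : ideal_gen S x -> ideal_gen S (- x).
Proof. by rewrite -mulN1r; apply: ideal_genM. Qed.

Lemma ideal_genB S x y : ideal_gen S x -> ideal_gen S y -> ideal_gen S (x - y).
Proof. by move=> Sx /ideal_genN; apply: ideal_genD. Qed.

Lemma mem_ideal_gen S x : S x -> ideal_gen S x.
Proof.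
move=> Sx; exists [:: (1, x)]; last by rewrite big_seq1 mul1r.
by move=> c; rewrite inE => /eqP ->.
Qed.

Lemma ideal_gen_sum S (I : Type) (r : seq I) (P : pred I) (F : I -> R) :
  (forall i, P i -> ideal_gen S (F i)) -> ideal_gen S (\sum_(i <- r | P i) F i).
Proof.
move=> SF; elim/big_rec: _ => [|i x Pi Sx]; first exact: ideal_gen0.
by apply: ideal_genD => //; apply: SF.
Qed.

Lemma ideal_gen_sub S S' : (forall x, S x -> ideal_gen S' x) ->
  forall x, ideal_gen S x -> ideal_gen S' x.
Proof.
move=> SS' x [s Ss ->]; rewrite big_seq; apply: ideal_gen_sum => c /Ss Sc.
by apply: ideal_genM; apply: SS'.
Qed.

(** Grouping the terms of a combination by generator: coefficients become a
    function of the generator, which is what the comparison of two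
    expansions over a minimal system needs. *)
Lemma ideal_gen_seqP fs x : ideal_gen (fun f => f \in fs) x ->
  uniq fs -> exists a : R -> R, x = \sum_(f <- fs) a f * f.
Proof.
move=> [s Ss ->] fs_uniq; exists (fun f => \sum_(c <- s | c.2 == f) c.1).
under [RHS]eq_bigr do rewrite mulr_suml big_mkcond.
rewrite exchange_big /= big_seq [RHS]big_seq; apply: eq_bigr => c /Ss fs_c.
rewrite (bigD1_seq c.2) //= eqxx big1 ?addr0 // => f.
by rewrite eq_sym => /negPf ->.
Qed.

Lemma ideal_gen_cat fs gs z :
  ideal_gen (fun f => f \in fs ++ gs) z ->
  ideal_add (ideal_gen (fun f => f \in fs)) (ideal_gen (fun f => f \in gs)) z.
Proof.
case=> cs st_cs ->; rewrite (bigID (fun c => c.2 \in fs)) /=.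
exists (\sum_(c <- cs | c.2 \in fs) c.1 * c.2).
exists (\sum_(c <- cs | c.2 \notin fs) c.1 * c.2); split=> //.
  by apply: ideal_gen_sum => c sc; apply/ideal_genM/mem_ideal_gen.
rewrite big_seq_cond; apply: ideal_gen_sum => c /andP[/st_cs + Nsc].
by rewrite mem_cat (negPf Nsc) => tc; apply/ideal_genM/mem_ideal_gen.
Qed.

End IdealGen.

(** * Words of chords and their crossing normal form *)

Section CrossingWords.

Variables (R : comNzRingType) (S : R -> Prop).
Variables (x : nat -> nat -> R) (E : rel nat) (N : nat).

Definition chord (e : nat * nat) := [&& e.1 < e.2, e.2 < N & E e.1 e.2]%N.

(** Lower ends come before upper ends: for a sorted, pairwise crossing word
    this concatenation is itself sorted. *)
Definition word_ends (s : seq (nat * nat)) := unzip1 s ++ unzip2 s.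

Definition word_monomial (s : seq (nat * nat)) := \prod_(e <- s) x e.1 e.2.

(** The quadratic moves: inside the graph [E] and modulo the ideal, both
    non-crossing matchings of four points can be traded for the crossing one. *)
Definition can_cross :=
  forall a b c d, (a < b < c)%N -> (c < d < N)%N ->
    (E a b -> E c d ->
       [/\ E a c, E b d & ideal_gen S (x a b * x c d - x a c * x b d)]) /\
    (E a d -> E b c ->
       [/\ E a c, E b d & ideal_gen S (x a d * x b c - x a c * x b d)]).

(** Two chords whose open segments meet or that share an end; a chord crosses
    itself in this sense, which lets multiple edges stay in a normal form. *)
Definition crossing (e f : nat * nat) :=
  [&& f.1 <= e.2, e.1 <= f.2, (e.1 < f.1) ==> (e.2 <= f.2)
    & (f.1 < e.1) ==> (f.2 <= e.2)]%N.

(** The sum of the squares of the two arcs cut off by a chord of a circle with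
    [N] points. Convexity makes the crossing pair the lightest matching. *)
Definition chord_weight (e : nat * nat) :=
  ((N - (e.2 - e.1)) ^ 2 + (e.2 - e.1) ^ 2)%N.

Lemma chord_weight_crossing a b c d : (a < b < c)%N -> (c < d < N)%N ->
  (chord_weight (a, c) + chord_weight (b, d)
    < minn (chord_weight (a, b) + chord_weight (c, d))
           (chord_weight (a, d) + chord_weight (b, c)))%N.
Proof.
move=> /andP[ab bc] /andP[cd dN]; rewrite /chord_weight /= !expnS !expn0 !muln1.
(* Let p, q, r, k be the four arcs between a, b, c, d. The crossing pair is
   lighter by 4qk than the first matching and by 4pr than the second. *)
have [p def_b p0] : exists2 p, b = (a + p)%N & (0 < p)%N
  by exists (b - a)%N; lia.
have [q def_c q0] : exists2 q, c = (a + p + q)%N & (0 < q)%N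
  by exists (c - (a + p))%N; lia.
have [r def_d r0] : exists2 r, d = (a + p + q + r)%N & (0 < r)%N
  by exists (d - (a + p + q))%N; lia.
have [k def_N k0] : exists2 k, N = (p + q + r + k)%N & (0 < k)%N
  by exists (N - (p + q + r))%N; lia.
rewrite def_N def_d def_c def_b {ab bc cd dN def_N def_d def_c def_b}.
have -> : (a + p + q - a = p + q)%N by lia.
have -> : (a + p + q + r - (a + p) = q + r)%N by lia.
have -> : (a + p - a = p)%N by lia.
have -> : (a + p + q + r - (a + p + q) = r)%N by lia.
have -> : (a + p + q + r - a = p + q + r)%N by lia.
have -> : (a + p + q - (a + p) = q)%N by lia.
have -> : (p + q + r + k - (p + q) = r + k)%N by lia.
have -> : (p + q + r + k - (q + r) = p + k)%N by lia.
have -> : (p + q + r + k - p = q + r + k)%N by lia.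
have -> : (p + q + r + k - r = p + q + k)%N by lia.
have -> : (p + q + r + k - (p + q + r) = k)%N by lia.
have -> : (p + q + r + k - q = p + r + k)%N by lia.
nia.
Qed.

Lemma cross_pair e f : can_cross -> chord e -> chord f -> ~~ crossing e f ->
  exists e' f', [/\ chord e', chord f',
    (chord_weight e' + chord_weight f' < chord_weight e + chord_weight f)%N,
    perm_eq [:: e.1; e.2; f.1; f.2] [:: e'.1; e'.2; f'.1; f'.2]
    & ideal_gen S (x e.1 e.2 * x f.1 f.2 - x e'.1 e'.2 * x f'.1 f'.2)].
Proof.
move=> cross; wlog lt_ef : e f / (e.1 < f.1)%N => [wl|].
  move=> Ce Cf; have [ef|fe|eq_ef] := ltngtP e.1 f.1; first exact: wl.
    have sym : crossing e f = crossing f e.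
      by rewrite /crossing andbCA; congr [&& _, _ & _]; rewrite andbC.
    rewrite sym => /(wl f e fe Cf Ce)[e' [f' [Ce' Cf' wt pm id]]].
    exists e', f'; split=> //; first by rewrite [X in (_ < X)%N]addnC.
      by rewrite (permPl (_ : perm_eq _ [:: f.1; f.2; e.1; e.2])) //
                 (perm_catC [:: e.1; e.2] [:: f.1; f.2]).
    by rewrite [X in X - _]mulrC.
  move: Ce Cf => /and3P[lt_e _ _] /and3P[lt_f _ _].
  by rewrite /crossing eq_ef ltnn /= andbT; lia.
case: e f lt_ef => [a b] [c d] /= ac.
rewrite /chord /crossing /= => /and3P[ab bN Eab] /and3P[cd dN Ecd] bad.
have [bc|cb] := ltnP b c.
  have [| |/(_ Eab Ecd)[Eac Ebd id] _] := cross a b c d; try lia.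
  have wt := @chord_weight_crossing a b c d ltac:(lia) ltac:(lia).
  exists (a, c), (b, d); split=> //=; try (apply/and3P; split=> //; lia).
    by lia.
  by apply/permP => P /=; lia.
have db : (d < b)%N by lia.
have [| |_ /(_ Eab Ecd)[Eac Ebd id]] := cross a c d b; try lia.
have wt := @chord_weight_crossing a c d b ltac:(lia) ltac:(lia).
exists (a, d), (c, b); split=> //=; try (apply/and3P; split=> //; lia).
  by lia.
by apply/permP => P /=; lia.
Qed.

(** Each move lowers the total weight, and when no move applies all pairs of
    chords cross. *)
Lemma crossing_normal_form s : can_cross -> all chord s ->
  exists t, [/\ all chord t, all2rel crossing t,
    perm_eq (word_ends s) (word_ends t)
    & ideal_gen S (word_monomial s - word_monomial t)].
Proof.
move=> cross; have [w] := ubnP (\sum_(e <- s) chord_weight e)%N.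
elim: w s => // w IHw s le_sw Cs.
have [good|] := boolP (all2rel crossing s).
  by exists s; split=> //; rewrite subrr; apply: ideal_gen0.
move=> /allPn[e es] /allPn[f fs bad].
have fe : f != e.
  apply: contraNneq bad => ->; have /and3P[lt_e _ _] := allP Cs e es.
  by rewrite /crossing ltnn (ltnW lt_e).
have fse : f \in rem e s by apply: rem_mem.
have s_perm : perm_eq s [:: e, f & rem f (rem e s)].
  by rewrite (permPl (perm_to_rem es)) perm_cons perm_to_rem.
set r := rem f _ in s_perm.
move: Cs; rewrite (perm_all _ s_perm) /= => /and3P[Ce Cf Cr].
have [e' [f' [Ce' Cf' wt pm id]]] := cross_pair cross Ce Cf bad.
move: le_sw; rewrite (perm_big _ s_perm) !big_cons /= => le_w.
have [|/=|t [Ct good pm' id']] := IHw [:: e', f' & r].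
- by rewrite !big_cons; clear -wt le_w; lia.
- by rewrite Ce' Cf'.
exists t; split=> //.
  apply: perm_trans pm'; apply/permP => P.
  have := permP (perm_map fst s_perm) P; have := permP (perm_map snd s_perm) P.
  have := permP pm P.
  rewrite /word_ends /unzip1 /unzip2 !count_cat /= => h1 h2 h3.
  by clear -h1 h2 h3; lia.
rewrite -[word_monomial s](subrK (word_monomial [:: e', f' & r])) -addrA.
apply: ideal_genD => //; rewrite /word_monomial (perm_big _ s_perm) !big_cons.
by rewrite /= !mulrA -mulrBl mulrC; apply: ideal_genM.
Qed.

Definition lex_chord (e f : nat * nat) :=
  ((e.1 < f.1) || (e.1 == f.1) && (e.2 <= f.2))%N.

(** In a lexicographically sorted crossing word the lower ends increase, the
    upper ends increase, and every lower end is at most every upper end. So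
    the word is read off from the sorted list of its ends. *)
Lemma crossing_sorted_ends s : all chord s -> all2rel crossing s ->
  word_ends (sort lex_chord s) = sort leq (word_ends s).
Proof.
move=> Cs good; set t := sort lex_chord s.
have lex_total : total lex_chord by move=> e f; rewrite /lex_chord; lia.
have lex_trans : transitive lex_chord by move=> e f g; rewrite /lex_chord; lia.
have t_s : perm_eq t s by apply/permPl/perm_sort.
have t_lex : pairwise lex_chord t by rewrite -sorted_pairwise // sort_sorted.
have t_good e f : e \in t -> f \in t -> crossing e f.
  by rewrite !(perm_mem t_s) => es; apply: (allP (allP good e es)).
have -> : sort leq (word_ends s) = sort leq (word_ends t).
  apply/(perm_sortP leq_total leq_trans anti_leq).
  by rewrite perm_cat // perm_map // perm_sym.
symmetry; apply: sorted_sort; first exact: leq_trans.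
rewrite sorted_pairwise; last exact: leq_trans.
rewrite /word_ends pairwise_cat !pairwise_map; apply/and3P; split.
- apply/allrelP => a b /mapP[e et ->] /mapP[f ft ->].
  by have /and4P[] := t_good e f et ft.
- by apply: sub_pairwise t_lex => e f; rewrite /lex_chord /=; lia.
apply: (sub_in_pairwise _ (allss t)) t_lex => e f et ft /=.
have /and4P[_ _ + _] := t_good e f et ft.
by rewrite /lex_chord; case: ltngtP => //= _.
Qed.

Lemma word_ends_inj s t : size s = size t -> word_ends s = word_ends t -> s = t.
Proof.
move=> sz /eqP; rewrite eqseq_cat ?size_map // => /andP[/eqP e1 /eqP e2].
by rewrite -(zip_unzip s) -(zip_unzip t) e1 e2.
Qed.

(** Both words reduce to the same normal form, since a crossing word is
    determined by the multiset of its ends. *)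
Lemma word_monomial_congr s t : can_cross -> all chord s -> all chord t ->
  perm_eq (word_ends s) (word_ends t) ->
  ideal_gen S (word_monomial s - word_monomial t).
Proof.
move=> cross Cs Ct st.
have [s' [Cs' s'_good ss' id_s]] := crossing_normal_form cross Cs.
have [t' [Ct' t'_good tt' id_t]] := crossing_normal_form cross Ct.
have s't' : perm_eq (word_ends s') (word_ends t').
  by rewrite -(permPl ss') -(permPr tt').
have eq_sz : size s' = size t'.
  by have := perm_size s't'; rewrite !size_cat !size_map; clear; lia.
have eq_sort : sort lex_chord s' = sort lex_chord t'.
  apply: word_ends_inj; rewrite ?size_sort // !crossing_sorted_ends //.
  exact/(perm_sortP leq_total leq_trans anti_leq).
have -> : word_monomial s - word_monomial t =
    (word_monomial s - word_monomial s') - (word_monomial t - word_monomial t').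
  have -> : word_monomial s' = word_monomial t'; last by ring.
  apply: perm_big; rewrite -(perm_sort lex_chord) eq_sort.
  by rewrite perm_sort.
exact: ideal_genB.
Qed.

End CrossingWords.

(** * Toric ideals and degree vectors *)

Section ToricIdeal.

Variables (K : fieldType) (T : finType) (G : graph T).
Local Notation p := #|verts G|.
Local Notation q := #|edges G|.
Implicit Types (f g : {mpoly K[q]}) (u v w : 'X_{1..q}) (i j : 'I_q).

Lemma card_edge (e : {set T}) : e \in edges G -> #|e| = 2%N.
Proof. by move/(forall_inP (edgesP G))/andP => [/eqP]. Qed.

Lemma edge_sub_verts (e : {set T}) : e \in edges G -> e \subset verts G.
Proof. by move/(forall_inP (edgesP G))/andP => []. Qed.

Definition incidence i : 'X_{1..p} :=
  [multinom (enum_val j \in enum_val i : nat) | j < p].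

(** The exponent of the image of the monomial of exponent [u], that is the
    vector of vertex degrees of the multigraph [u]. *)
Definition degrees u : 'X_{1..p} := (\sum_i incidence i *+ u i)%MM.

Lemma edge_monomialE i : edge_monomial K i = 'X_[incidence i].
Proof.
rewrite /edge_monomial mpolyXE_id big_mkcond /=; apply: eq_bigr => j _.
by rewrite mnmE; case: (_ \in _); rewrite ?expr1 ?expr0.
Qed.

Lemma toric_mapX u : toric_map 'X_[u] = 'X_[degrees u] :> {mpoly K[p]}.
Proof.
rewrite /toric_map comp_mpolyX.
rewrite [RHS](big_morph _ (@mpolyXD _ _) (@mpolyX0 _ _)); apply: eq_bigr => i _.
by rewrite tnth_mktuple edge_monomialE mpolyXn.
Qed.

Lemma toric_mapD f g : toric_map (f + g) = toric_map f + toric_map g.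
Proof. exact: raddfD. Qed.

Lemma toric_mapB f g : toric_map (f - g) = toric_map f - toric_map g.
Proof. exact: raddfB. Qed.

Lemma toric_map_sum f :
  toric_map f = \sum_(u <- msupp f) f@_u *: 'X_[degrees u].
Proof.
rewrite {1}[f]mpolyE /toric_map raddf_sum; apply: eq_bigr => u _ /=.
by rewrite comp_mpolyZ -toric_mapX.
Qed.

Lemma toric_ideal_gen (S : {mpoly K[q]} -> Prop) f :
  (forall g, S g -> toric_ideal g) -> ideal_gen S f -> toric_ideal f.
Proof.
move=> S0 [s Ss ->]; rewrite /toric_ideal /toric_map raddf_sum big_seq big1 //=.
by move=> c /Ss/S0 c0; rewrite rmorphM /= [X in _ * X]c0 mulr0.
Qed.

Lemma toric_ideal_binomial u v :
  toric_ideal ('X_[u] - 'X_[v] : {mpoly K[q]}) <-> degrees u = degrees v.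
Proof.
rewrite /toric_ideal toric_mapB !toric_mapX; split=> [/subr0_eq|->].
  move/(congr1 (mcoeff (degrees v))); rewrite !mcoeffX eqxx.
  by case: eqP => // _ /eqP; rewrite eq_sym oner_eq0.
by rewrite subrr.
Qed.

Lemma degreesD u v : degrees (u + v) = (degrees u + degrees v)%MM.
Proof.
rewrite /degrees -big_split; apply: eq_bigr => i _ /=.
by apply/mnmP => j; rewrite !(mnmDE, mulmnE) mulnDr.
Qed.

Lemma degreesU i : degrees U_(i) = incidence i.
Proof.
rewrite /degrees (bigD1 i) //= mnm1E eqxx mulm1n big1 ?addm0 // => j.
by rewrite mnm1E eq_sym => /negPf ->; rewrite mulm0n.
Qed.

Lemma degreesE u (j : 'I_p) : degrees u j
  = (\sum_i u i * (enum_val j \in enum_val i))%N.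
Proof.
by rewrite mnm_sumE; apply: eq_bigr => i _; rewrite mulmnE mnmE mulnC.
Qed.

Lemma mdeg_incidence i : mdeg (incidence i) = 2%N.
Proof.
have e_i := enum_valP i; rewrite mdegE; under eq_bigr do rewrite mnmE.
rewrite -[RHS](card_edge e_i) -[RHS]sum1_card.
rewrite -(big_enum_val (fun x => nat_of_bool (x \in enum_val i))) /=.
rewrite big_mkcond [RHS]big_mkcond /=; apply: eq_bigr => x _.
case: ifP => // xNG; case: ifP => // xe.
by rewrite (subsetP (edge_sub_verts e_i) _ xe) in xNG.
Qed.

Lemma mdeg_degrees u : mdeg (degrees u) = (2 * mdeg u)%N.
Proof.
rewrite mdeg_sum mdegE big_distrr; apply: eq_bigr => i _ /=.
by rewrite mdegMn mdeg_incidence.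
Qed.

Lemma incidence_inj : injective incidence.
Proof.
move=> i j eq_ij; apply: enum_val_inj; apply/setP => x.
have [xG|xNG] := boolP (x \in verts G).
  have /mnmP/(_ (enum_rank_in xG x)) := eq_ij.
  by rewrite !mnmE enum_rankK_in //; do 2!case: (_ \in _).
have out (k : 'I_q) : x \notin enum_val k.
  by apply: contra xNG; apply/subsetP/edge_sub_verts/enum_valP.
by rewrite (negPf (out i)) (negPf (out j)).
Qed.

(** A graph is simple, so a single edge is known from its ends. This is why
    elements of toric ideals have no term of degree at most one. *)
Lemma degrees_inj_low u w : (mdeg w <= 1)%N -> degrees u = degrees w -> u = w.
Proof.
move=> w_le1 eq_uw; have := congr1 mdeg eq_uw; rewrite !mdeg_degrees => eq_d.
have {}eq_d : mdeg u = mdeg w by lia.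
case: (ltngtP (mdeg w) 1) w_le1 eq_d => // [w0|/eqP/mdeg1P[i /eqP w_i]] _.
  have /eqP : mdeg w = 0%N by lia.
  by rewrite mdeg_eq0 => /eqP -> /eqP; rewrite mdeg0 mdeg_eq0 => /eqP.
rewrite w_i mdeg1 => /eqP/mdeg1P[j /eqP u_j].
by move: eq_uw; rewrite w_i u_j !degreesU => /incidence_inj ->.
Qed.

(** Monomials of one fibre have one image, and the sum is the coefficient of
    that image in the image of [f]. *)
Lemma toric_ideal_fiber f u : toric_ideal f ->
  \sum_(v <- msupp f | degrees v == degrees u) f@_v = 0.
Proof.
move=> /(congr1 (mcoeff (degrees u))); rewrite toric_map_sum mcoeff0 => coef0.
rewrite -[RHS]coef0 raddf_sum big_mkcond; apply: eq_bigr => v _ /=.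
by rewrite mcoeffZ mcoeffX; case: eqP; rewrite ?mulr1 ?mulr0.
Qed.

Lemma toric_ideal_low f w : toric_ideal f -> (mdeg w <= 1)%N -> f@_w = 0.
Proof.
move=> f0 w_low; have [f_w|/memN_msupp_eq0 //] := boolP (w \in msupp f).
rewrite -[RHS](toric_ideal_fiber w f0) (eq_bigl (pred1 w)).
  by rewrite -big_filter filter_pred1_uniq ?msupp_uniq // big_seq1.
by move=> v /=; apply/eqP/eqP => [|-> //]; apply: degrees_inj_low.
Qed.

(** Toric ideals are spanned by binomials, with control of the monomials used:
    replace each monomial of [f] by a chosen monomial of [f] in the same fibre;
    what is left cancels fibre by fibre. *)
Lemma toric_ideal_span (S : {mpoly K[q]} -> Prop) (P : 'X_{1..q} -> Prop) f :
    toric_ideal f -> (forall u, u \in msupp f -> P u) ->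
    (forall u v, P u -> P v -> degrees u = degrees v ->
       ideal_gen S ('X_[u] - 'X_[v])) ->
  ideal_gen S f.
Proof.
move=> f0 Pf Sbin.
pose rep z := head 0%MM [seq v <- msupp f | degrees v == z].
have rep_f u : u \in msupp f ->
    rep (degrees u) \in msupp f /\ degrees (rep (degrees u)) = degrees u.
  move=> fu; have : u \in [seq v <- msupp f | degrees v == degrees u].
    by rewrite mem_filter eqxx.
  rewrite /rep; have : all (fun v => (v \in msupp f) && (degrees v == degrees u))
      [seq v <- msupp f | degrees v == degrees u].
    by apply/allP => v; rewrite mem_filter andbC.
  by case: [seq _ <- _ | _] => // v s /= /andP[/andP[-> /eqP ->]].
have -> : f = \sum_(u <- msupp f) f@_u *: ('X_[u] - 'X_[rep (degrees u)]).
  rewrite {1}[f]mpolyE; apply/eqP; rewrite -subr_eq0 -sumrB; apply/eqP.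
  under eq_bigr do rewrite -scalerBr opprB addrC subrK.
  pose ds := undup [seq degrees u | u <- msupp f].
  transitivity (\sum_(u <- msupp f) \sum_(z <- ds | degrees u == z)
                  f@_u *: 'X_[rep z] : {mpoly K[q]}).
    rewrite big_seq [RHS]big_seq; apply: eq_bigr => u fu.
    rewrite (eq_bigl (pred1 (degrees u))) => [|z]; last by rewrite /= eq_sym.
    rewrite -big_filter filter_pred1_uniq ?undup_uniq ?big_seq1 //.
    by rewrite mem_undup map_f.
  rewrite (exchange_big_dep xpredT) //= big_seq big1 // => z.
  rewrite mem_undup => /mapP[u fu ->].
  by rewrite -scaler_suml toric_ideal_fiber ?scale0r.
rewrite big_seq; apply: ideal_gen_sum => u fu.
have [fr deg_r] := rep_f u fu.
by rewrite -mul_mpolyC; apply/ideal_genM/Sbin => //; apply: Pf.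
Qed.

End ToricIdeal.

(** * Toric ideals of subgraphs *)

Section CompMpoly.

Variables (R : comNzRingType) (m n l : nat).

Lemma comp_mpolyA (f : {mpoly R[m]}) (s : m.-tuple {mpoly R[n]})
    (t : n.-tuple {mpoly R[l]}) :
  (f \mPo s) \mPo t = f \mPo [tuple tnth s i \mPo t | i < m].
Proof.
rewrite (comp_mpolyEX f s) raddf_sum [RHS]comp_mpolyEX; apply: eq_bigr => u _.
rewrite /= comp_mpolyZ !comp_mpolyX rmorph_prod; congr (_ *: _).
by apply: eq_bigr => i _; rewrite rmorphXn tnth_mktuple.
Qed.

(** A term of [a] of positive degree would meet a coefficient of [f] in a degree
    below that of [w]. *)
Lemma mcoeffM_low (a f : {mpoly R[n]}) w :
  (forall v, (mdeg v < mdeg w)%N -> f@_v = 0) -> (a * f)@_w = a@_0%MM * f@_w.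
Proof.
move=> f_low; have a_dec : a = (a@_0%MM)%:MP + (a - (a@_0%MM)%:MP).
  by rewrite addrC subrK.
rewrite {1}a_dec mulrDl mcoeffD mcoeffCM mcoeffM big1 ?addr0 // => -[u v] /=.
move=> /eqP w_uv; have [u0|u_neq0] := eqVneq (val u) 0%MM.
  by rewrite u0 mcoeffB mcoeffC eqxx mulr1 subrr mul0r.
rewrite f_low ?mulr0 //; rewrite [ltnRHS](congr1 mdeg w_uv) mdegD.
by rewrite -[ltnLHS]add0n ltn_add2r lt0n mdeg_eq0.
Qed.

End CompMpoly.

Section Subgraph.

Variables (K : fieldType) (T : finType) (H G : graph T) (sHG : subgraph H G).
Local Notation q := #|edges G|.
Implicit Types (f g : {mpoly K[q]}) (h : {mpoly K[#|edges H|]}).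

Definition supported (u : 'X_{1..q}) :=
  [forall i, (u i != 0%N) ==> (enum_val i \in edges H)].

Lemma edge_index_val i : enum_val (edge_index sHG i) = enum_val i.
Proof.
by rewrite /edge_index enum_rankK_in // (subgraph_edges sHG) // enum_valP.
Qed.

(** The two monomial maps agree up to the inclusion of the vertex variables of
    [H] in those of [G], which is injective: it is undone by sending the other
    variables to zero. *)
Lemma toric_ideal_incl h :
  toric_ideal (edge_ring_incl sHG h) <-> toric_ideal h.
Proof.
have sV : {subset verts H <= verts G} by case/andP: sHG => /subsetP.
pose vidx (j : 'I_#|verts H|) : 'I_#|verts G| :=
  enum_rank_in (sV _ (enum_valP j)) (enum_val j).
have vidxK j : enum_val (vidx j) = enum_val j.
  by rewrite /vidx enum_rankK_in // sV // enum_valP.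
pose vincl := [tuple 'X_(vidx j) : {mpoly K[_]} | j < #|verts H|].
pose vproj := [tuple if [pick j | vidx j == k] is Some j then 'X_j else 0
                 : {mpoly K[#|verts H|]} | k < #|verts G|].
have vinclK (g : {mpoly K[#|verts H|]}) : (g \mPo vincl) \mPo vproj = g.
  rewrite comp_mpolyA -[RHS]comp_mpoly_id; congr (_ \mPo _).
  apply: eq_mktuple => j; rewrite tnth_mktuple comp_mpolyXU -tnth_nth.
  rewrite tnth_mktuple; case: pickP => [j' /eqP jj'|/(_ j)]; last by rewrite eqxx.
  by congr 'X_(_); apply: enum_val_inj; rewrite -!vidxK jj'.
have toric_incl : toric_map (edge_ring_incl sHG h) = toric_map h \mPo vincl.
  rewrite /toric_map /edge_ring_incl !comp_mpolyA; congr (_ \mPo _).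
  apply: eq_mktuple => i; rewrite !tnth_mktuple comp_mpolyXU -tnth_nth.
  rewrite tnth_mktuple /edge_monomial edge_index_val rmorph_prod /=.
  have /card_gt0P[x xi] : (0 < #|enum_val i|)%N.
    by rewrite (@card_edge _ H) ?enum_valP.
  have xH : x \in verts H.
    by apply: subsetP xi; apply: edge_sub_verts (enum_valP i).
  rewrite (reindex vidx) /=.
    apply: eq_big => j; first by rewrite vidxK.
    by move=> _; rewrite comp_mpolyXU -tnth_nth tnth_mktuple.
  exists (fun k => enum_rank_in xH (enum_val k)) => [j _|k].
    by apply: enum_val_inj; rewrite vidxK enum_rankK_in // enum_valP.
  rewrite inE => ki; apply: enum_val_inj; rewrite vidxK enum_rankK_in //.
  by apply: subsetP ki; apply: edge_sub_verts (enum_valP i).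
rewrite /toric_ideal toric_incl; split=> [|->]; last by rewrite comp_mpoly0.
by move/(congr1 (comp_mpoly vproj)); rewrite vinclK comp_mpoly0.
Qed.

Lemma supported_incl h u : u \in msupp (edge_ring_incl sHG h) -> supported u.
Proof.
apply: contraLR => /forallPn[i]; rewrite negb_imply => /andP[ui NHi].
rewrite -mcoeff_eq0 /edge_ring_incl comp_mpolyEX raddf_sum big1 // => v _ /=.
rewrite mcoeffZ comp_mpolyX.
under eq_bigr do rewrite tnth_mktuple mpolyXn.
rewrite -(big_morph _ (@mpolyXD _ _) (@mpolyX0 _ _)) mcoeffX.
case: eqP => [uE|]; rewrite ?mulr0 //; case/eqP: ui; rewrite -uE mnm_sumE.
rewrite big1 // => j _; rewrite mulmnE mnm1E; case: eqP => // ij.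
by case/negP: NHi; rewrite -ij edge_index_val enum_valP.
Qed.

Lemma subgraph_ideal_toric f : subgraph_ideal sHG f -> toric_ideal f.
Proof.
by apply: toric_ideal_gen => g [h h0 ->]; apply/toric_ideal_incl.
Qed.

(** An element of the big toric ideal that uses only edges of [H] is the image
    of an element of the toric ideal of [H]: send the other edges to zero. *)
Lemma subgraph_ideal_supported f :
    toric_ideal f -> (forall u, u \in msupp f -> supported u) ->
  subgraph_ideal sHG f.
Proof.
move=> f0 f_supp.
pose back i : {mpoly K[#|edges H|]} :=
  if [pick j | edge_index sHG j == i] is Some j then 'X_j else 0.
have f_incl : edge_ring_incl sHG (f \mPo [tuple back i | i < q]) = f.
  rewrite /edge_ring_incl comp_mpolyA comp_mpolyEX [RHS]mpolyE big_seq.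
  rewrite [RHS]big_seq; apply: eq_bigr => u fu; congr (_ *: _).
  rewrite comp_mpolyX mpolyXE_id; apply: eq_bigr => i _.
  rewrite !tnth_mktuple; have [->|ui] := eqVneq (u i) 0%N; first by rewrite !expr0.
  congr (_ ^+ _); rewrite /back; case: pickP => [j /eqP <-|none].
    by rewrite comp_mpolyXU -tnth_nth tnth_mktuple.
  have Hi := implyP (forallP (f_supp u fu) i) ui.
  have := none (enum_rank_in Hi (enum_val i)); case/eqP.
  by apply: enum_val_inj; rewrite edge_index_val enum_rankK_in.
apply: mem_ideal_gen; exists (f \mPo [tuple back i | i < q]) => //.
by apply/toric_ideal_incl; rewrite f_incl.
Qed.

(** Elements of the extended ideal may use all the variables, but in their
    lowest possible degree, two, only edges of [H] occur. *)
Lemma subgraph_ideal_quadric f u : subgraph_ideal sHG f -> mdeg u = 2%N ->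
  ~~ supported u -> f@_u = 0.
Proof.
case=> s Hs -> u2 Nu; rewrite raddf_sum big_seq big1 //= => c /Hs[h h0 ->].
rewrite mcoeffM_low => [|v]; last first.
  by rewrite u2; apply: toric_ideal_low; apply/toric_ideal_incl.
rewrite (@memN_msupp_eq0 _ _ (edge_ring_incl _ _)) ?mulr0 //.
by apply: contra Nu; apply: supported_incl.
Qed.

Lemma subgraph_ideal_full :
  edges G \subset edges H -> ideal_eq (subgraph_ideal sHG) (@toric_ideal K _ G).
Proof.
move=> /subsetP sGH f; split; first exact: subgraph_ideal_toric.
move=> f0; apply: subgraph_ideal_supported => // u _.
by apply/forallP => i; rewrite sGH ?implybT ?enum_valP.
Qed.

End Subgraph.

(** * Binomials of degree two *)

Section EdgeMonomials.

Variables (K : fieldType) (T : finType) (G : graph T).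
Implicit Types (e f : {set T}) (H : graph T).

(** The exponent of the variable of [e], defined for every set so that no proof
    of membership is carried around; it is zero when [e] is not an edge. *)
Definition edge_exp e : 'X_{1..#|edges G|} :=
  [multinom (enum_val i == e : nat) | i < #|edges G|].

Lemma edge_exp_val (i : 'I_#|edges G|) : edge_exp (enum_val i) = U_(i)%MM.
Proof.
by apply/mnmP => j; rewrite mnmE mnm1E eq_sym (inj_eq enum_val_inj).
Qed.

Lemma edge_ind (P : {set T} -> Prop) :
  (forall i : 'I_#|edges G|, P (enum_val i)) -> forall e, e \in edges G -> P e.
Proof. by move=> Pi e Ge; rewrite -(enum_rankK_in Ge Ge). Qed.

Lemma mdeg_edge_exp e : e \in edges G -> mdeg (edge_exp e) = 1%N.
Proof. by elim/edge_ind => i; rewrite edge_exp_val mdeg1. Qed.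

Lemma degrees_edge_exp e j : e \in edges G ->
  degrees (edge_exp e) j = (enum_val j \in e).
Proof. by elim/edge_ind => i; rewrite edge_exp_val degreesU mnmE. Qed.

Lemma edge_expD_mem e f1 f2 f3 : e \in edges G ->
  (edge_exp e + edge_exp f1 = edge_exp f2 + edge_exp f3)%MM ->
  (e == f2) || (e == f3).
Proof.
elim/edge_ind => i /mnmP/(_ i); rewrite !mnmDE !mnmE eqxx.
by do 3!case: (_ == _).
Qed.

Lemma supported_edge_expD H e f : e \in edges G -> f \in edges G ->
  supported H (edge_exp e + edge_exp f) = (e \in edges H) && (f \in edges H).
Proof.
elim/edge_ind => i; elim/edge_ind => j; apply/forallP/andP => [supp|[Hi Hj] k].
  by split; [have := supp i | have := supp j];
    rewrite mnmDE !mnmE eqxx ?addn1.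
apply/implyP; rewrite mnmDE !mnmE.
case: (enum_val k =P enum_val i) => [->|_] //.
by case: (enum_val k =P enum_val j) => [->|_].
Qed.

End EdgeMonomials.

Section MinimalGenerators.

Variables (K : fieldType) (T : finType) (G : graph T).
Local Notation q := #|edges G|.
Implicit Types (f g b : {mpoly K[q]}) (fs gs : seq {mpoly K[q]}).

Definition quadratic f := all (fun u => mdeg u == 2%N) (msupp f).

(** Toric binomials are homogeneous: equal vertex degrees give equal numbers
    of edges. *)
Lemma binomial_quadratic f w : toric_ideal f -> binomial_mpoly f ->
  mdeg w = 2%N -> ~~ quadratic f -> f@_w = 0.
Proof.
move=> f0 [u [v f_uv]] w2; apply: contraNeq => fw.
have mdeg_uv : mdeg u = mdeg v.
  move: f0; rewrite f_uv => /toric_ideal_binomial/(congr1 mdeg).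
  by rewrite !mdeg_degrees; lia.
have mdeg_supp w' : f@_w' != 0 -> mdeg w' = mdeg u.
  rewrite f_uv mcoeffB !mcoeffX; case: (u =P w') => [-> //|_].
  by case: (v =P w') => [<-|_]; rewrite ?subrr ?eqxx.
apply/allP => w'; rewrite mcoeff_msupp => /mdeg_supp ->.
by rewrite -(mdeg_supp w fw) w2.
Qed.

(** Taking degree two parts: only the quadratic generators and the constant
    terms of their cofactors survive. *)
Lemma quadratic_combination fs (a : {mpoly K[q]} -> {mpoly K[q]}) b :
    (forall f, f \in fs -> toric_ideal f /\ binomial_mpoly f) -> quadratic b ->
    b = \sum_(f <- fs) a f * f ->
  b = \sum_(f <- fs | quadratic f) (a f)@_0%MM *: f.
Proof.
move=> fsP b_quad b_eq; apply/mpolyP => w.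
have [w2|w2] := eqVneq (mdeg w) 2%N; last first.
  rewrite raddf_sum memN_msupp_eq0 ?big1 //= => [f f_quad|].
    rewrite mcoeffZ (@memN_msupp_eq0 _ _ f) ?mulr0 //.
    by apply: contra w2; apply: (allP f_quad).
  by apply: contra w2; apply: (allP b_quad).
rewrite b_eq !raddf_sum big_seq [RHS]big_mkcond [RHS]big_seq.
apply: eq_bigr => f /fsP[f0 f_bin]; rewrite /= mcoeffM_low => [|v].
  by case: ifPn => [_|/(binomial_quadratic f0 f_bin w2) ->];
    rewrite ?mcoeffZ ?mulr0.
by rewrite w2; apply: toric_ideal_low.
Qed.

(** Expanding [b] over both systems gives a linear relation between quadratic
    generators. If [b] were nonzero, the relation would express some member of
    [fs] by the remaining generators, against minimality. *)
Lemma quadratic_common_eq0 fs gs b :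
    minimal_generators (fs ++ gs) (@toric_ideal K _ G) ->
    (forall f, f \in fs ++ gs -> binomial_mpoly f) -> quadratic b ->
    ideal_gen (fun f => f \in fs) b -> ideal_gen (fun g => g \in gs) b ->
  b = 0.
Proof.
move=> [uniq_fg gen_fg min_fg] bin_fg b_quad fs_b gs_b.
have fgP f : f \in fs ++ gs -> toric_ideal f /\ binomial_mpoly f.
  by split; [apply/gen_fg/mem_ideal_gen | apply: bin_fg].
have [fs_uniq gs_uniq] : uniq fs /\ uniq gs.
  by move: uniq_fg; rewrite cat_uniq => /and3P[].
have [a b_fs] := ideal_gen_seqP fs_b fs_uniq.
have [c b_gs] := ideal_gen_seqP gs_b gs_uniq.
have {}b_fs : b = \sum_(f <- fs | quadratic f) (a f)@_0%MM *: f.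
  by apply: quadratic_combination b_fs => // f fs_f;
    apply: fgP; rewrite mem_cat fs_f.
have {}b_gs : b = \sum_(g <- gs | quadratic g) (c g)@_0%MM *: g.
  by apply: quadratic_combination b_gs => // f gs_f;
    apply: fgP; rewrite mem_cat gs_f orbT.
have [/hasP[f0 fs_f0 /andP[f0_quad a0]]|/hasPn a_eq0] :=
    boolP (has (fun f => quadratic f && ((a f)@_0%MM != 0)) fs); last first.
  rewrite b_fs big_seq_cond big1 // => f /andP[/a_eq0 + f_quad].
  by rewrite f_quad /= negbK => /eqP ->; rewrite scale0r.
pose L := rem f0 (fs ++ gs).
have in_L f : f \in fs ++ gs -> f != f0 -> ideal_gen (fun g => g \in L) f.
  by move=> fg_f ff0; apply: mem_ideal_gen; rewrite mem_rem_uniq // !inE ff0.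
have f0_L : ideal_gen (fun g => g \in L) f0.
  have -> : f0 = ((a f0)@_0%MM)^-1 *:
      (b - \sum_(f <- fs | quadratic f && (f != f0)) (a f)@_0%MM *: f).
    rewrite b_fs -big_filter (bigD1_seq f0) ?filter_uniq ?mem_filter ?f0_quad //=.
    rewrite big_filter_cond addrK.
    by rewrite scalerA mulVf // scale1r.
  rewrite -mul_mpolyC; apply: ideal_genM; apply: ideal_genB.
    rewrite b_gs big_seq_cond; apply: ideal_gen_sum => g /andP[gs_g _].
    rewrite -mul_mpolyC; apply/ideal_genM/in_L; first by rewrite mem_cat gs_g orbT.
    apply: contraTneq gs_g => ->; move: uniq_fg; rewrite cat_uniq.
    by case/and3P => _ /hasPn dis _; apply: contraL fs_f0 => /dis.
  rewrite big_seq_cond; apply: ideal_gen_sum => f /and3P[fs_f _ ff0].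
  by rewrite -mul_mpolyC; apply/ideal_genM/in_L => //; rewrite mem_cat fs_f.
have : f0 \in L.
  apply: min_fg; last by rewrite mem_cat fs_f0.
    by move=> f; apply: mem_rem.
  move=> x; rewrite -(gen_fg x); split; apply: ideal_gen_sub => f.
    by move/mem_rem => fg_f; apply: mem_ideal_gen.
  by have [->|ff0] := eqVneq f f0 => // fg_f; apply: in_L.
by rewrite mem_rem_uniqF.
Qed.

End MinimalGenerators.

Section CompleteGraph.

Variables (K : fieldType) (n : nat).
Local Notation Kn := (complete_graph n).
Implicit Types a b c d : 'I_n.

Definition pairing a b c d : 'X_{1..#|edges Kn|} :=
  (edge_exp Kn [set a; b] + edge_exp Kn [set c; d])%MM.

Lemma complete_edge a b : ([set a; b] \in edges Kn) = (a != b).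
Proof. by rewrite inE cards2; case: (a != b). Qed.

Lemma mdeg_pairing a b c d : a != b -> c != d -> mdeg (pairing a b c d) = 2%N.
Proof. by move=> ab cd; rewrite mdegD !mdeg_edge_exp ?complete_edge. Qed.

Lemma supported_pairing (H : graph 'I_n) a b c d : a != b -> c != d ->
  supported H (pairing a b c d)
    = ([set a; b] \in edges H) && ([set c; d] \in edges H).
Proof. by move=> ab cd; rewrite supported_edge_expD ?complete_edge. Qed.

Lemma eq_set2 a b c d :
  ([set a; b] == [set c; d]) = (a == c) && (b == d) || (a == d) && (b == c).
Proof.
apply/eqP/orP => [eq_s|[]/andP[/eqP-> /eqP->] //]; last exact: setUC.
have : a \in [set c; d] by rewrite -eq_s set21.
have : b \in [set c; d] by rewrite -eq_s set22.
have : c \in [set a; b] by rewrite eq_s set21.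
have : d \in [set a; b] by rewrite eq_s set22.
rewrite !inE ![c == _]eq_sym ![d == _]eq_sym.
move: (a == c) (a == d) (b == c) (b == d) => [] [] [] [] //=; by [left | right].
Qed.

Lemma in_set2_nat (a b j : 'I_n) : a != b ->
  (j \in [set a; b] : nat) = ((j == a) + (j == b))%N.
Proof.
by move=> ab; rewrite !inE; case: (j =P a) => [->|//]; rewrite (negPf ab).
Qed.

Definition swap_binomial a b c d : {mpoly K[#|edges Kn|]} :=
  'X_[pairing a b c d] - 'X_[pairing a c b d].

Lemma swap_binomial_toric a b c d :
  uniq [:: a; b; c; d] -> toric_ideal (swap_binomial a b c d).
Proof.
rewrite /= !inE !negb_or => /and4P[/and3P[ab ac ad] /andP[bc bd] cd _].
apply/toric_ideal_binomial/mnmP => j; rewrite !degreesD !mnmDE.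
by rewrite !degrees_edge_exp ?complete_edge // !in_set2_nat // addnACA.
Qed.

Lemma pairing_neq a b c d : uniq [:: a; b; c; d] ->
  pairing a b c d != pairing a c b d.
Proof.
rewrite /= !inE !negb_or => /and4P[/and3P[ab ac ad] /andP[bc bd] cd _].
apply/eqP; rewrite /pairing => eq_p.
have := edge_expD_mem (G := Kn) _ eq_p; rewrite complete_edge => /(_ ab).
by rewrite !eq_set2 eqxx (negPf bc) (negPf ab) (negPf ac) (negPf ad).
Qed.

Lemma swap_binomial_coef a b c d : uniq [:: a; b; c; d] ->
  (swap_binomial a b c d)@_(pairing a b c d) = 1.
Proof.
move=> /pairing_neq/negPf neq.
by rewrite /swap_binomial mcoeffB !mcoeffX eqxx eq_sym neq subr0.
Qed.

Lemma swap_binomial_quadratic a b c d : a != b -> c != d -> a != c -> b != d ->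
  quadratic (swap_binomial a b c d).
Proof.
move=> ab cd ac bd; apply/allP => u; rewrite mcoeff_msupp mcoeffB !mcoeffX.
case: (_ =P u) => [<-|_]; first by rewrite mdeg_pairing.
by case: (_ =P u) => [<-|_]; rewrite ?mdeg_pairing // subrr eqxx.
Qed.

Lemma swap_binomial_supported (H : graph 'I_n) a b c d u :
    a != b -> c != d -> a != c -> b != d ->
    [set a; b] \in edges H -> [set c; d] \in edges H ->
    [set a; c] \in edges H -> [set b; d] \in edges H ->
  u \in msupp (swap_binomial a b c d) -> supported H u.
Proof.
move=> ab cd ac bd Hab Hcd Hac Hbd; rewrite mcoeff_msupp mcoeffB !mcoeffX.
case: (_ =P u) => [<-|_]; first by rewrite supported_pairing // Hab.
by case: (_ =P u) => [<-|_]; rewrite ?subrr ?eqxx // supported_pairing ?Hac.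
Qed.

End CompleteGraph.

(** * Six or more vertices *)

Section NoSplitting.

Variables (K : fieldType) (n : nat).
Local Notation Kn := (complete_graph n).
Variables (G1 G2 : graph 'I_n) (s1 : subgraph G1 Kn) (s2 : subgraph G2 Kn).
Implicit Types a b c d x y z : 'I_n.

(** Compare the coefficients of the monomial of the matching [ab, cd] in an
    expression of [swap_binomial a b c d] as a sum: it must occur in one of the
    two ideals. *)
Lemma splitting_pairing a b c d :
    ideal_eq (@toric_ideal K _ Kn)
      (ideal_add (subgraph_ideal s1) (subgraph_ideal s2)) ->
    uniq [:: a; b; c; d] ->
  ([set a; b] \in edges G1) && ([set c; d] \in edges G1)
  || ([set a; b] \in edges G2) && ([set c; d] \in edges G2).
Proof.
move=> splitting abcd; have := abcd.
rewrite /= !inE !negb_or => /and4P[/and3P[ab _ _] _ cd _].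
rewrite -!supported_pairing //; apply: contraT; rewrite negb_or => /andP[N1 N2].
have [f1 [f2 [I1 I2 f12]]] := (splitting _).1 (swap_binomial_toric K abcd).
have := swap_binomial_coef K abcd; rewrite f12 mcoeffD.
rewrite (subgraph_ideal_quadric I1) ?(subgraph_ideal_quadric I2) ?mdeg_pairing //.
by move/eqP; rewrite addr0 eq_sym oner_eq0.
Qed.

(** The binomial of a 4-cycle lying in both subgraphs would be a nonzero
    quadratic element of both ideals. *)
Lemma minimal_splitting_cycle a b c d :
    minimal_splitting K s1 s2 -> uniq [:: a; b; c; d] ->
  ~~ [&& [set a; b] \in edges G1 :&: edges G2,
         [set c; d] \in edges G1 :&: edges G2,
         [set a; c] \in edges G1 :&: edges G2
       & [set b; d] \in edges G1 :&: edges G2].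
Proof.
move=> [_ [fs [gs [[[_ gen1 _] bin1] [[_ gen2 _] bin2] min]]]] abcd.
have := abcd; rewrite /= !inE !negb_or.
case/and4P => /and3P[ab ac ad] /andP[bc bd] cd _.
apply/negP => /and4P[/andP[? ?] /andP[? ?] /andP[? ?] /andP[? ?]].
suff b0 : swap_binomial K a b c d = 0.
  have := swap_binomial_coef K abcd; rewrite b0 mcoeff0 => /eqP.
  by rewrite eq_sym oner_eq0.
apply: quadratic_common_eq0 min _ _ _ _.
- by move=> f; rewrite mem_cat => /orP[/bin1|/bin2].
- exact: swap_binomial_quadratic.
- apply/gen1/subgraph_ideal_supported; first exact: swap_binomial_toric.
  by move=> u; apply: swap_binomial_supported.
- apply/gen2/subgraph_ideal_supported; first exact: swap_binomial_toric.
  by move=> u; apply: swap_binomial_supported.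
Qed.

Lemma more_vertices (s : seq 'I_n) k : uniq s -> (size s + k <= n)%N ->
  exists2 t, size t = k & uniq (s ++ t).
Proof.
move=> s_uniq le_skn; pose r := filter [predC s] (enum 'I_n).
have r_uniq : uniq r by rewrite filter_uniq // enum_uniq.
have le_kr : (k <= size r)%N.
  have := count_predC (mem s) (enum 'I_n).
  rewrite -[X in (_ + X)%N]size_filter -/r size_enum_ord => sz.
  have : (count (mem s) (enum 'I_n) <= size s)%N.
    rewrite -size_filter; apply: uniq_leq_size.
      by rewrite filter_uniq // enum_uniq.
    by move=> w; rewrite mem_filter => /andP[].
  by lia.
exists (take k r); first by rewrite size_take_min; apply/minn_idPl.
rewrite cat_uniq s_uniq take_uniq // andbT.
by apply/hasPn => w /mem_take; rewrite mem_filter => /andP[].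
Qed.

Hypotheses (n_ge6 : (6 <= n)%N) (min12 : minimal_splitting K s1 s2).

Local Ltac distinct :=
  rewrite /= ?inE ?negb_or; repeat (apply/andP; split); by rewrite // eq_sym.

(** Suppose that [xy] and [xz] are missing, from the first and from the second
    subgraph. Edges disjoint from [xz] lie in the first subgraph and edges
    disjoint from [xy] in the second, so among [z] and three further vertices
    only edges at [z] can be missing, and only from the first subgraph; two of
    them must be, to break all three 4-cycles. Likewise two edges at [y] are
    missing from the second subgraph, and two of the missing edges, one at [z]
    and one at [y], are disjoint. *)
Lemma missing_edges_not_adjacent x y z : uniq [:: x; y; z] ->
  [set x; y] \notin edges G1 -> [set x; z] \in edges G2.
Proof.
move=> xyz N1; apply: contraT => N2.
have [[|w1 [|w2 [|w3 []]]] // _] := more_vertices xyz n_ge6.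
rewrite /= !inE !negb_or -!andbA.
case/and5P => xy xz x1 x2 /and5P[x3 yz y1 y2 /and5P[y3 z1 z2 z3 /and4P[a12 a13 a23 _]]].
have [[split12 _ _] _] := min12.
have pair a b c d : uniq [:: a; b; c; d] -> ([set a; b] \notin edges G1 ->
    [set c; d] \in edges G2) /\ ([set a; b] \notin edges G2 ->
    [set c; d] \in edges G1).
  by case/(splitting_pairing split12)/orP => /andP[-> ->].
have in1 c d : uniq [:: x; z; c; d] -> [set c; d] \in edges G1.
  by move=> u; apply: (pair x z c d u).2.
have in2 c d : uniq [:: x; y; c; d] -> [set c; d] \in edges G2.
  by move=> u; apply: (pair x y c d u).1.
have zcycle c d e : uniq [:: x; y; z; c; d; e] ->
    ~~ (([set z; c] \in edges G1) && ([set z; d] \in edges G1)).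
  rewrite /= !inE !negb_or -!andbA.
  case/and5P => ? ? ? ? /and5P[? ? ? ? /and5P[? ? ? ? /and4P[? ? ? _]]].
  have /minimal_splitting_cycle : uniq [:: z; c; d; e] by distinct.
  move=> /(_ min12); apply: contra => /andP[E1 E2].
  by rewrite !inE E1 E2 !in1 ?in2 //; distinct.
have ycycle c d e : uniq [:: x; y; z; c; d; e] ->
    ~~ (([set y; c] \in edges G2) && ([set y; d] \in edges G2)).
  rewrite /= !inE !negb_or -!andbA.
  case/and5P => ? ? ? ? /and5P[? ? ? ? /and5P[? ? ? ? /and4P[? ? ? _]]].
  have /minimal_splitting_cycle : uniq [:: y; c; d; e] by distinct.
  move=> /(_ min12); apply: contra => /andP[E1 E2].
  by rewrite !inE E1 E2 !in1 ?in2 //; distinct.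
have cross c d : uniq [:: z; c; y; d] ->
    ([set z; c] \in edges G1) || ([set y; d] \in edges G2).
  by move=> /pair[zc _]; apply: contraT; rewrite negb_or => /andP[/zc ->].
have z12 := zcycle w1 w2 w3 ltac:(distinct).
have z13 := zcycle w1 w3 w2 ltac:(distinct).
have y13 := ycycle w1 w3 w2 ltac:(distinct).
have y23 := ycycle w2 w3 w1 ltac:(distinct).
have c12 := cross w1 w2 ltac:(distinct).
have c13 := cross w1 w3 ltac:(distinct).
have c21 := cross w2 w1 ltac:(distinct).
have c31 := cross w3 w1 ltac:(distinct).
have c23 := cross w2 w3 ltac:(distinct).
move: z12 z13 y13 y23 c12 c13 c21 c31 c23.
case: ([set z; w1] \in _) => /= [|_ _]; last first.
  by move=> _ y23 r2 r3; rewrite r2 r3 in y23.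
by move=> /negPf -> /negPf -> y13 _ _ _ /= r1 _ r3; rewrite r1 r3 in y13.
Qed.

Lemma no_minimal_splitting : False.
Proof.
have [[split12 ne1 ne2] _] := min12.
have missing (H : graph 'I_n) (s : subgraph H Kn) :
    ~ ideal_eq (subgraph_ideal s) (@toric_ideal K _ Kn) ->
    exists x y, x != y /\ [set x; y] \notin edges H.
  move=> ne; have /subsetPn[e] : ~~ (edges Kn \subset edges H).
    by apply/negP => sub; apply/ne/subgraph_ideal_full.
  by rewrite inE => /cards2P[x [y [xy ->]]] NH; exists x, y.
have [x [y [xy N1]]] := missing _ _ ne1.
have [z [t [zt N2]]] := missing _ _ ne2.
have same a b : a != b -> [set a; b] \notin edges G1 ->
    [set a; b] \in edges G2.
  move=> ab Nab; have [||[|c [|d []]] // _ abcd] := @more_vertices [:: a; b] 2.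
  - by rewrite /= inE ab.
  - exact: leq_trans n_ge6.
  have := splitting_pairing split12 abcd.
  by rewrite (negPf Nab) => /andP[].
have adj a b c : a != b -> [set a; b] \notin edges G1 -> c != a ->
    [set a; c] \in edges G2.
  move=> ab Nab ca; have [->|cb] := eqVneq c b; first exact: same.
  by apply: missing_edges_not_adjacent Nab; distinct.
case/negP: N2; have [z_x|zx] := eqVneq z x.
  by rewrite z_x; apply: (adj x y) => //; rewrite -z_x eq_sym.
have [z_y|zy] := eqVneq z y.
  rewrite z_y; apply: (adj y x); last by rewrite -z_y eq_sym.
    by rewrite eq_sym.
  by rewrite setUC.
have [t_x|tx] := eqVneq t x; first by rewrite t_x setUC; apply: (adj x y).
have [t_y|ty] := eqVneq t y.
  by rewrite t_y setUC; apply: (adj y x); rewrite // 1?eq_sym // setUC.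
have xyzt : uniq [:: x; y; z; t] by distinct.
by have := splitting_pairing split12 xyzt; rewrite (negPf N1) => /andP[].
Qed.

End NoSplitting.

(** * From monomials to words of chords *)

Section Labelling.

Variables (K : fieldType) (n : nat) (lab : nat -> 'I_n) (pos : 'I_n -> nat).
Hypotheses (posK : cancel pos lab)
  (labK : forall i, (i < n)%N -> pos (lab i) = i)
  (pos_lt : forall a, (pos a < n)%N).
Local Notation Kn := (complete_graph n).
Local Notation q := #|edges Kn|.

Definition lab_edge i j : {set 'I_n} := [set lab i; lab j].

Definition edge_var i j : {mpoly K[q]} := 'X_[edge_exp Kn (lab_edge i j)].

Lemma edge_varC i j : edge_var i j = edge_var j i.
Proof. by rewrite /edge_var /lab_edge setUC. Qed.

Lemma lab_inj i j : (i < n)%N -> (j < n)%N -> (lab i == lab j) = (i == j).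
Proof.
move=> i_lt j_lt; apply/eqP/eqP => [|->//] /(congr1 pos).
by rewrite !labK.
Qed.

(** The positions of the ends of [e], the lower one first; the value on sets
    that are not edges is a dummy. *)
Definition edge_chord (e : {set 'I_n}) : nat * nat :=
  if [pick p : 'I_n * 'I_n | (p.1 < p.2)%N && (e == lab_edge p.1 p.2)] is Some p
  then (val p.1, val p.2) else (0, 0)%N.

Lemma edge_chordP e : e \in edges Kn ->
  [/\ (edge_chord e).1 < (edge_chord e).2, (edge_chord e).2 < n
    & e = lab_edge (edge_chord e).1 (edge_chord e).2]%N.
Proof.
rewrite inE => /cards2P[a [b [ab ->]]]; rewrite /edge_chord.
case: pickP => [[i j] /= /andP[ij /eqP ->] //|none].
wlog lt_ab : a b ab none / (pos a < pos b)%N => [wl|].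
  have [|ba|/(can_inj posK) eq_ab] := ltngtP (pos a) (pos b); first exact: wl.
    by rewrite setUC in none *; apply: wl; rewrite // eq_sym.
  by rewrite eq_ab eqxx in ab.
have := none (Ordinal (pos_lt a), Ordinal (pos_lt b)).
by rewrite /lab_edge /= lt_ab !posK eqxx.
Qed.

Definition exp_word (u : 'X_{1..q}) : seq (nat * nat) :=
  flatten [seq nseq (u i) (edge_chord (enum_val i)) | i <- enum 'I_q].

Lemma exp_word_monomial u : word_monomial edge_var (exp_word u) = 'X_[u].
Proof.
rewrite /word_monomial /exp_word big_flatten /= big_map big_enum mpolyXE_id.
apply: eq_bigr => i _; rewrite big_nseq iter_mulr_1; congr (_ ^+ _).
have [_ _ e_def] := edge_chordP (enum_valP i).
by rewrite /edge_var -e_def edge_exp_val.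
Qed.

Lemma exp_word_chord (H : graph 'I_n) u : supported H u ->
  all (chord (fun i j => lab_edge i j \in edges H) n) (exp_word u).
Proof.
move=> /forallP suppH; apply/allP => e /flatten_mapP[i _].
rewrite mem_nseq => /andP[ui /eqP ->]; have := implyP (suppH i).
rewrite -lt0n => /(_ ui); have [lt_e e_n {1}->] := edge_chordP (enum_valP i).
by rewrite /chord lt_e e_n.
Qed.

Lemma count_word_ends (P : pred nat) s :
  count P (word_ends s) = (\sum_(e <- s) (P e.1 + P e.2))%N.
Proof.
rewrite /word_ends count_cat !count_map -!sum1_count big_split.
by congr (_ + _)%N; rewrite big_mkcond; apply: eq_bigr => e _ /=; case: (P _).
Qed.

(** Counting ends of chords by a predicate only sees vertex degrees, so words
    of monomials in the same fibre have the same multiset of ends. *)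
Lemma exp_word_ends (P : pred nat) u : count P (word_ends (exp_word u)) =
  (\sum_j degrees u j * P (pos (enum_val j)))%N.
Proof.
rewrite count_word_ends /exp_word big_flatten /= big_map big_enum /=.
transitivity (\sum_(j < #|verts Kn|) \sum_(i < q) u i *
    ((enum_val j \in enum_val i) * P (pos (enum_val j))))%N; last first.
  apply: eq_bigr => j _; rewrite /= (degreesE u j) big_distrl.
  by apply: eq_bigr => i _ /=; rewrite mulnA.
rewrite exchange_big; apply: eq_bigr => i _ /=.
rewrite big_nseq iter_addn_0.
have [lt_e e_n e_def] := edge_chordP (enum_valP i).
rewrite -big_distrr mulnC /=; congr (_ * _)%N.
rewrite -(big_enum_val (fun a => (a \in enum_val i) * P (pos a))%N) /=.
transitivity (\sum_(a in enum_val i) P (pos a))%N; last first.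
  rewrite big_mkcond [RHS]big_mkcond; apply: eq_bigr => a _ /=.
  by rewrite in_setT; case: (a \in _); rewrite ?mul1n.
have e1_n := ltn_trans lt_e e_n.
rewrite {3}e_def big_setU1 ?big_set1 ?labK //=.
by rewrite inE lab_inj // neq_ltn lt_e.
Qed.

(** If the quadratic moves are available inside [H], they generate every toric
    relation between edges of [H]. *)
Lemma crossing_span (H : graph 'I_n) (S : {mpoly K[q]} -> Prop) f :
    can_cross S edge_var (fun i j => lab_edge i j \in edges H) n ->
    toric_ideal f -> (forall u, u \in msupp f -> supported H u) ->
  ideal_gen S f.
Proof.
move=> cross f0 f_supp; apply: toric_ideal_span f0 f_supp _ => u v Hu Hv uv.
rewrite -!exp_word_monomial; apply: word_monomial_congr cross _ _ _.
- exact: exp_word_chord.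
- exact: exp_word_chord.
by apply/permP => P; rewrite !exp_word_ends uv.
Qed.

End Labelling.

(** * Minimality by dual monomials *)

Section DualMonomials.

Variables (K : fieldType) (T : finType) (G : graph T) (I : eqType).
Local Notation q := #|edges G|.
Variables (F : I -> {mpoly K[q]}) (w : I -> 'X_{1..q}) (ks : seq I).
Hypotheses (ks_uniq : uniq ks)
  (F_toric : forall k, k \in ks -> toric_ideal (F k))
  (w_deg : forall k, k \in ks -> mdeg (w k) = 2%N)
  (F_w : forall k l, k \in ks -> l \in ks -> ((F l)@_(w k) != 0) = (k == l)).

(** If a generator were redundant, its coefficient at its own monomial would,
    for lack of terms of degree below two, be a combination of the coefficients
    of the others there, which vanish. *)
Lemma dual_monomials_minimal (J : {mpoly K[q]} -> Prop) :
  generates (map F ks) J -> minimal_generators (map F ks) J.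
Proof.
move=> gen; have F_inj : {in ks &, injective F}.
  move=> k l ks_k ks_l eq_F; apply/eqP; rewrite -F_w //.
  by rewrite -eq_F F_w ?eqxx.
split=> [||gs sub_gs gen_gs _ /mapP[k ks_k ->]]; rewrite ?map_inj_in_uniq //.
apply: contraT => NFk; have : J (F k) by apply/gen/mem_ideal_gen/map_f.
case/gen_gs => s gs_s Fk; have := F_w ks_k ks_k; rewrite eqxx {1}Fk.
rewrite raddf_sum big_seq big1 ?eqxx //= => c /gs_s gs_c.
have /mapP[l ks_l c_l] := sub_gs _ gs_c; rewrite mcoeffM_low => [|v].
  apply/eqP; rewrite mulf_eq0; apply/orP; right.
  rewrite c_l -[_ == 0]negbK F_w //.
  by apply: contraNneq NFk => ->; rewrite -c_l.
by rewrite w_deg // c_l; apply: toric_ideal_low (F_toric ks_l).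
Qed.

End DualMonomials.

(** * The complete graph minus two disjoint edges *)

Section SplittingFactor.

Variables (K : fieldType) (n : nat) (lab : nat -> 'I_n) (pos : 'I_n -> nat).
Hypotheses (posK : cancel pos lab)
  (labK : forall i, (i < n)%N -> pos (lab i) = i)
  (pos_lt : forall a, (pos a < n)%N).
Hypotheses (n_ge4 : (4 <= n)%N) (n_le5 : (n <= 5)%N).
Local Notation Kn := (complete_graph n).
Local Notation q := #|edges Kn|.
Local Notation edge := (lab_edge lab).
Local Notation x := (edge_var K lab).

Definition deleted_edges := edges Kn :\: [set edge 0 1; edge 2 3].

Lemma deleted_edgesP :
  [forall e in deleted_edges, (#|e| == 2%N) && (e \subset [set: 'I_n])].
Proof. by apply/forall_inP => e; rewrite !inE subsetT andbT => /andP[]. Qed.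

Definition deleted_graph : graph 'I_n := Graph deleted_edgesP.

Lemma deleted_subgraph : subgraph deleted_graph Kn.
Proof. by rewrite /subgraph subxx subsetDl. Qed.

Definition same_pair (p r : nat * nat) := (p == r) || (p == (r.2, r.1)).

Lemma lab_edge_eq i j k l : (i < n)%N -> (j < n)%N -> (k < n)%N -> (l < n)%N ->
  (edge i j == edge k l) = same_pair (i, j) (k, l).
Proof. by move=> *; rewrite eq_set2 !(lab_inj labK) // -!xpair_eqE. Qed.

Lemma mem_deleted i j : (i < n)%N -> (j < n)%N ->
  (edge i j \in deleted_edges)
    = [&& i != j, ~~ same_pair (i, j) (0, 1)%N & ~~ same_pair (i, j) (2, 3)%N].
Proof.
move=> i_n j_n; rewrite in_setD complete_edge (lab_inj labK) // andbC.
by rewrite !inE negb_or !lab_edge_eq // (leq_trans _ n_ge4).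
Qed.

(** An entry [(a, b, c, d)] stands for the binomial x_ab x_cd - x_ac x_bd on one
    of the sets of four labels. The edge [ab] is always 02 or 13: these are the
    edges that the other subgraph lacks, so the first monomial is available in
    this subgraph only. *)
Definition quad_list : seq (nat * nat * nat * nat) :=
  [:: (0, 2, 3, 1); (0, 2, 4, 1); (1, 3, 4, 0); (0, 2, 3, 4); (1, 3, 2, 4)]%N.

Definition quads : seq (nat * nat * nat * nat) :=
  [seq k <- quad_list | all (fun i => i < n)%N [:: k.1.1.1; k.1.1.2; k.1.2; k.2]].

Definition quad_binomial (k : nat * nat * nat * nat) : {mpoly K[q]} :=
  swap_binomial K (lab k.1.1.1) (lab k.1.1.2) (lab k.1.2) (lab k.2).

Definition quad_gens := map quad_binomial quads.

Lemma quad_binomialE a b c d :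
  quad_binomial (a, b, c, d) = x a b * x c d - x a c * x b d.
Proof. by rewrite /quad_binomial /swap_binomial !mpolyXD. Qed.

Definition quad_ok (k : nat * nat * nat * nat) :=
  let: (a, b, c, d) := k in
  let allowed i j := ~~ same_pair (i, j) (0, 1)%N && ~~ same_pair (i, j) (2, 3)%N in
  [&& uniq [:: a; b; c; d], allowed a b, allowed c d, allowed a c & allowed b d].

Lemma quadsP a b c d : (a, b, c, d) \in quads ->
  [/\ (a < n)%N, (b < n)%N, (c < n)%N, (d < n)%N & quad_ok (a, b, c, d)].
Proof.
rewrite mem_filter => /andP[lt_n /(allP (isT : all quad_ok quad_list)) ok].
by move: lt_n => /= /and5P[*]; split.
Qed.

Lemma lab_uniq a b c d : (a < n)%N -> (b < n)%N -> (c < n)%N -> (d < n)%N ->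
  uniq [:: lab a; lab b; lab c; lab d] = uniq [:: a; b; c; d].
Proof.
by move=> *; rewrite /= !inE !(lab_inj labK).
Qed.

Lemma quad_toric k : k \in quads -> toric_ideal (quad_binomial k).
Proof.
case: k => [[[a b] c] d] /quadsP[an bn cn dn /andP[u _]].
by apply: swap_binomial_toric; rewrite lab_uniq.
Qed.

Lemma four_subsets a b c d : (a < b < c)%N -> (c < d < n)%N ->
  (a, b, c, d) = (0, 1, 2, 3)%N \/ (4 < n)%N /\
  [\/ (a, b, c, d) = (0, 1, 2, 4)%N, (a, b, c, d) = (0, 1, 3, 4)%N,
      (a, b, c, d) = (0, 2, 3, 4)%N | (a, b, c, d) = (1, 2, 3, 4)%N].
Proof.
move=> /andP[ab bc] /andP[cd dn].
have [d3|d3] := leqP d 3; [left | right].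
  by congr (_, _, _, _); lia.
have -> : d = 4%N by lia.
split; first by lia.
have [c3|c3] := leqP c 2; first by constructor 1; congr (_, _, _, _); lia.
have -> : c = 3%N by lia.
have [b2|b2] := leqP b 1; first by constructor 2; congr (_, _, _, _); lia.
have -> : b = 2%N by lia.
by have [a1|a1] := posnP a; [constructor 3 | constructor 4];
  congr (_, _, _, _); lia.
Qed.

Lemma small_quad : (0, 2, 3, 1)%N \in quads.
Proof. by rewrite mem_filter /= !(leq_trans _ n_ge4). Qed.

Lemma large_quads k : (4 < n)%N ->
  k \in [:: (0, 2, 4, 1); (1, 3, 4, 0); (0, 2, 3, 4); (1, 3, 2, 4)]%N ->
  k \in quads.
Proof.
move=> n_gt4 k_in; rewrite mem_filter [X in _ && X]inE k_in orbT andbT.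
by move: k_in; rewrite !inE => /or4P[] /eqP -> /=; rewrite !(leq_trans _ n_gt4).
Qed.

(** The deleted edges 01 and 23 join neighbours in the cyclic order of the
    labels, hence are never part of a crossing pair; for each set of four
    labels exactly one non-crossing matching survives, and [quad_list] trades
    it for the crossing one. *)
Lemma deleted_can_cross (J : {mpoly K[q]} -> Prop) :
  (forall f, f \in quad_gens -> J f) ->
  can_cross J x (fun i j => edge i j \in edges deleted_graph) n.
Proof.
move=> JP a b c d abc cdn.
have gen a' b' c' d' : (a', b', c', d') \in quads ->
    ideal_gen J (x a' b' * x c' d' - x a' c' * x b' d').
  by rewrite -quad_binomialE => Qk; apply/mem_ideal_gen/JP/map_f.
have genN a' b' c' d' : (a', b', c', d') \in quads ->
    ideal_gen J (x a' c' * x b' d' - x a' b' * x c' d').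
  by move=> /gen/ideal_genN; rewrite opprB.
rewrite /= !mem_deleted; try lia.
case: (four_subsets abc cdn) => [[-> -> -> ->]|[n_gt4]].
  split=> // _ _; split=> //; rewrite (edge_varC _ _ 1 2) (edge_varC _ _ 1 3).
  exact/genN/small_quad.
have genL k := @large_quads k n_gt4.
case=> [] [-> -> -> ->]; split=> // _ _; split=> //.
- by rewrite (edge_varC _ _ 1 2) (edge_varC _ _ 1 4); apply/genN/genL.
- rewrite mulrC (edge_varC _ _ 0 4) [X in _ - X]mulrC (edge_varC _ _ 0 3).
  exact/gen/genL.
- exact/gen/genL.
- exact/genN/genL.
Qed.

Lemma quad_gens_deleted :
  generates quad_gens (subgraph_ideal deleted_subgraph).
Proof.
move=> f; split; apply: ideal_gen_sub => {}f.
  case/mapP=> [[[[a b] c] d] Qk ->].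
  have [an bn cn dn /and5P[u ab cd ac bd]] := quadsP Qk.
  apply: subgraph_ideal_supported; first exact: quad_toric.
  have := u; rewrite /= !inE !negb_or.
  case/and4P => /and3P[nab nac _] /andP[_ nbd] ncd _ w.
  apply: swap_binomial_supported; rewrite ?(lab_inj labK) //= -/(edge _ _);
    by rewrite mem_deleted // ?nab ?nac ?nbd ?ncd.
case=> h h0 ->; apply: (crossing_span posK labK pos_lt).
- by apply: deleted_can_cross.
- exact/toric_ideal_incl.
- by move=> u; apply: supported_incl.
Qed.

Lemma deleted_proper :
  ~ ideal_eq (subgraph_ideal deleted_subgraph) (@toric_ideal K _ Kn).
Proof.
have lt_n i : (i < 4)%N -> (i < n)%N by move=> /leq_trans; apply.
have u : uniq [:: lab 0; lab 1; lab 2; lab 3] by rewrite lab_uniq ?lt_n.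
move/(_ (swap_binomial K (lab 0) (lab 1) (lab 2) (lab 3))) => -[_].
move/(_ (swap_binomial_toric K u)) => mem; have := swap_binomial_coef K u.
rewrite (subgraph_ideal_quadric mem) => [/eqP||].
- by rewrite eq_sym oner_eq0.
- by rewrite mdeg_pairing // (lab_inj labK) ?lt_n.
- rewrite supported_pairing ?(lab_inj labK) ?lt_n //= -/(edge _ _).
  by rewrite mem_deleted ?lt_n.
Qed.

Definition quad_exp (k : nat * nat * nat * nat) : 'X_{1..q} :=
  pairing (lab k.1.1.1) (lab k.1.1.2) (lab k.1.2) (lab k.2).

Lemma pairing_same a b c d a' b' c' d' :
    all (fun i => i < n)%N [:: a; b; c; d; a'; b'; c'; d'] -> a != b -> c != d ->
    pairing (lab a') (lab b') (lab c') (lab d')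
      = pairing (lab a) (lab b) (lab c) (lab d) ->
  (same_pair (a, b) (a', b') || same_pair (a, b) (c', d')) &&
  (same_pair (c, d) (a', b') || same_pair (c, d) (c', d')).
Proof.
rewrite /= andbT => /and5P[an bn cn dn /and4P[an' bn' cn' dn']] ab cd.
rewrite /pairing => /esym eq_p; apply/andP; split; rewrite -!lab_edge_eq //.
  have abE : edge a b \in edges Kn by rewrite complete_edge (lab_inj labK).
  exact: (edge_expD_mem (G := Kn) abE eq_p).
have cdE : edge c d \in edges Kn by rewrite complete_edge (lab_inj labK).
by apply: (edge_expD_mem (G := Kn) cdE); rewrite addmC; apply: eq_p.
Qed.

(** Exchanging the labels 1 and 2 exchanges the edge sets {01, 23} and
    {02, 13}, so the second subgraph is the first one relabelled. *)
Definition swap12 (i : nat) : nat :=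
  if i == 1%N then 2 else if i == 2%N then 1 else i.

Lemma swap12K : involutive swap12. Proof. by case=> [|[|[]]]. Qed.

Lemma swap12_lt i : (i < n)%N -> (swap12 i < n)%N.
Proof.
move=> i_lt; rewrite /swap12; case: ifP => _; first by rewrite (leq_trans _ n_ge4).
by case: ifP => // _; rewrite (leq_trans _ n_ge4).
Qed.

Definition swap12_quad (k : nat * nat * nat * nat) :=
  (swap12 k.1.1.1, swap12 k.1.1.2, swap12 k.1.2, swap12 k.2).

Definition all_quads := quads ++ map swap12_quad quads.

(** A decidable criterion for the first monomial of [k] not to occur in the
    binomial of a different [l]: each of the two monomials of [l] lacks one
    of its edges. *)
Definition dual_ok (k l : nat * nat * nat * nat) :=
  let: (a, b, c, d) := k in let: (a', b', c', d') := l in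
  let same i j i' j' := (same_pair (a, b) (i, j) || same_pair (a, b) (i', j')) &&
     (same_pair (c, d) (i, j) || same_pair (c, d) (i', j')) in
  (k == l) || ~~ same a' b' c' d' && ~~ same a' c' b' d'.

Lemma all_quads_lt a b c d : (a, b, c, d) \in all_quads ->
  all (fun i => i < n)%N [:: a; b; c; d] && uniq [:: a; b; c; d].
Proof.
rewrite mem_cat => /orP[/quadsP[/= -> -> -> -> /andP[u _]] //|].
case/mapP=> [[[[a' b'] c'] d'] /quadsP[an bn cn dn /andP[u _]] [-> -> -> ->]].
rewrite /= !swap12_lt //=.
by have := map_inj_uniq (inv_inj swap12K) [:: a'; b'; c'; d'] => /= ->.
Qed.

Definition all_quad_list := quad_list ++ map swap12_quad quad_list.

Lemma all_quads_sub : subseq all_quads all_quad_list.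
Proof. by apply: cat_subseq; last apply: map_subseq; apply: filter_subseq. Qed.

Lemma all_quads_dual k l : k \in all_quads -> l \in all_quads -> dual_ok k l.
Proof.
have ok : all (fun k => all (dual_ok k) all_quad_list) all_quad_list by [].
move=> /(mem_subseq all_quads_sub) k_in /(mem_subseq all_quads_sub) l_in.
exact: (allP (allP ok k k_in)).
Qed.

Lemma all_quads_uniq : uniq all_quads.
Proof. exact: subseq_uniq all_quads_sub _. Qed.

Lemma quad_dual k l : k \in all_quads -> l \in all_quads ->
  ((quad_binomial l)@_(quad_exp k) != 0) = (k == l).
Proof.
move=> Qk Ql; have := all_quads_dual Qk Ql.
case: k l Qk Ql => [[[a b] c] d] [[[a' b'] c'] d'] /all_quads_lt /andP[lt u].
move=> /all_quads_lt /andP[lt' u']; rewrite /dual_ok.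
have [<- _|neq_kl /= /andP[N1 N2]] := eqVneq (a, b, c, d) (a', b', c', d').
  rewrite /quad_binomial swap_binomial_coef ?oner_eq0 // lab_uniq //;
    by move: lt => /= /and5P[].
have [ab cd] : a != b /\ c != d.
  by move: u; rewrite /= !inE !negb_or => /and4P[/and3P[-> _ _] _ -> _].
have neq i j i' j' : all (fun i => i < n)%N [:: a; b; c; d; i; j; i'; j'] ->
    ~~ ((same_pair (a, b) (i, j) || same_pair (a, b) (i', j')) &&
        (same_pair (c, d) (i, j) || same_pair (c, d) (i', j'))) ->
    pairing (lab i) (lab j) (lab i') (lab j') != quad_exp (a, b, c, d).
  by move=> lts; apply: contraNneq => /(pairing_same lts ab cd).
move: lt lt' => /= /and5P[an bn cn dn _] /and5P[an' bn' cn' dn' _].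
rewrite /quad_binomial /swap_binomial mcoeffB !mcoeffX /=.
rewrite (negPf (neq a' b' c' d' _ N1)) ?(negPf (neq a' c' b' d' _ N2)) ?subrr ?eqxx //=.
  by rewrite an bn cn dn an' bn' cn' dn'.
by rewrite an bn cn dn an' bn' cn' dn'.
Qed.

End SplittingFactor.

(** * Four or five vertices *)

Section SmallCompleteGraphs.

Variables (K : fieldType) (n : nat).
Hypotheses (n_ge4 : (4 <= n)%N) (n_le5 : (n <= 5)%N).
Local Notation Kn := (complete_graph n).

Let lab i : 'I_n := insubd (Ordinal n_ge4) i.
Let pos (a : 'I_n) : nat := a.
Let lab' i : 'I_n := lab (swap12 i).
Let pos' (a : 'I_n) : nat := swap12 a.

Lemma posK : cancel pos lab.
Proof. by move=> a; apply: val_inj; rewrite val_insubd ltn_ord. Qed.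

Lemma labK i : (i < n)%N -> pos (lab i) = i.
Proof. by move=> i_n; rewrite /pos val_insubd i_n. Qed.

Lemma pos_lt a : (pos a < n)%N. Proof. exact: ltn_ord. Qed.

Lemma posK' : cancel pos' lab'.
Proof. by move=> a; rewrite /pos' /lab' swap12K posK. Qed.

Lemma labK' i : (i < n)%N -> pos' (lab' i) = i.
Proof.
by move=> /(swap12_lt n_ge4) i_n; rewrite /pos' /lab' [nat_of_ord _]labK ?swap12K.
Qed.

Lemma pos_lt' a : (pos' a < n)%N. Proof. exact/(swap12_lt n_ge4)/ltn_ord. Qed.

Lemma quad_gens_swap :
  quad_gens K lab' = map (quad_binomial K lab) (map swap12_quad (quads n)).
Proof. by rewrite /quad_gens -map_comp. Qed.

(** For each set of four vertices the two families contribute two binomials,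
    which connect the three matchings. *)
Lemma complete_can_cross (J : {mpoly K[#|edges Kn|]} -> Prop) :
    (forall f, f \in quad_gens K lab ++ quad_gens K lab' -> J f) ->
  can_cross J (edge_var K lab) (fun i j => lab_edge lab i j \in edges Kn) n.
Proof.
move=> JP; have gen k : k \in quads n -> ideal_gen J (quad_binomial K lab k) /\
    ideal_gen J (quad_binomial K lab (swap12_quad k)).
  move=> Qk; split; apply/mem_ideal_gen/JP; rewrite mem_cat; apply/orP.
    by left; apply: map_f.
  by right; rewrite quad_gens_swap; do 2!apply: map_f.
move=> a b c d abc cdn; rewrite /= !complete_edge !(lab_inj labK); try lia.
set x := edge_var K lab.
suff [id1 id2] : ideal_gen J (x a b * x c d - x a c * x b d)
    /\ ideal_gen J (x a d * x b c - x a c * x b d).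
  by split=> _ _; split=> //; lia.
have xC : forall i j, x i j = x j i by exact: edge_varC.
have eq_mem y z : ideal_gen J y -> z = y -> ideal_gen J z by move=> ? ->.
case: (four_subsets n_ge4 n_le5 abc cdn) => [[-> -> -> ->]|[n_gt4]].
  have [] := gen _ (small_quad n_ge4); rewrite /= !quad_binomialE -/x => A B.
  split; [apply: (eq_mem _ _ (ideal_genB B A)) | apply: (eq_mem _ _ (ideal_genN A))].
    by rewrite (xC 3 2) (xC 3 1) (xC 2 1)%N; ring.
  by rewrite (xC 3 1) (xC 2 1)%N; ring.
have {}gen k Qk := gen k (large_quads n_gt4 Qk).
(* A1 to A4 come from the first subgraph and B1 to B4 from the second; A1 and
   B1 live on {0,1,2,4}, A2 and B2 on {0,1,3,4}, A3 and B3 on {0,2,3,4}, A4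
   and B4 on {1,2,3,4}. *)
have := gen (0, 2, 4, 1)%N isT; have := gen (1, 3, 4, 0)%N isT.
have := gen (0, 2, 3, 4)%N isT; have := gen (1, 3, 2, 4)%N isT.
rewrite /= !quad_binomialE -/x => -[A4 B4] [A3 B2] [A2 B3] [A1 B1].
have sort_vars := (xC 1 0, xC 2 0, xC 3 0, xC 4 0, xC 2 1, xC 3 1, xC 4 1,
                   xC 3 2, xC 4 2, xC 4 3)%N.
case=> [] [-> -> -> ->]; split.
- by apply: (eq_mem _ _ (ideal_genB B1 A1)); rewrite ?sort_vars; ring.
- by apply: (eq_mem _ _ (ideal_genN A1)); rewrite ?sort_vars; ring.
- by apply: (eq_mem _ _ B2); rewrite ?sort_vars; ring.
- by apply: (eq_mem _ _ A2); rewrite ?sort_vars; ring.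
- by apply: (eq_mem _ _ A3); rewrite ?sort_vars; ring.
- by apply: (eq_mem _ _ B3); rewrite ?sort_vars; ring.
- by apply: (eq_mem _ _ (ideal_genN A4)); rewrite ?sort_vars; ring.
- by apply: (eq_mem _ _ (ideal_genB B4 A4)); rewrite ?sort_vars; ring.
Qed.

Lemma quad_gens_cat : quad_gens K lab ++ quad_gens K lab' =
  map (quad_binomial K lab) (all_quads n).
Proof. by rewrite quad_gens_swap /quad_gens -map_cat. Qed.

Lemma all_quads_toric k : k \in all_quads n -> toric_ideal (quad_binomial K lab k).
Proof.
move=> Qk; case: k Qk => [[[a b] c] d] /(all_quads_lt n_ge4)/andP[lt u].
apply: swap_binomial_toric; rewrite (lab_uniq labK) //;
  by move: lt => /= /and5P[].
Qed.

Lemma complete_gens :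
  generates (quad_gens K lab ++ quad_gens K lab') (@toric_ideal K _ Kn).
Proof.
move=> f; split=> [|f0].
  apply: toric_ideal_gen => g; rewrite quad_gens_cat => /mapP[k Qk ->].
  exact: all_quads_toric.
apply: (crossing_span posK labK pos_lt (complete_can_cross _)) f0 _ => // u _.
by apply/forallP => i; rewrite enum_valP implybT.
Qed.

(** One computation of dual monomials serves the two subgraphs and the complete
    graph. *)
Lemma quad_gens_minimal ks (J : {mpoly K[#|edges Kn|]} -> Prop) :
    subseq ks (all_quads n) ->
  generates (map (quad_binomial K lab) ks) J ->
  minimal_generators (map (quad_binomial K lab) ks) J.
Proof.
move=> ks_sub; have sub := mem_subseq ks_sub.
apply: (dual_monomials_minimal (w := quad_exp lab)).
- by apply: subseq_uniq ks_sub _; apply: all_quads_uniq.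
- by move=> k /sub; apply: all_quads_toric.
- move=> [[[a b] c] d] /sub/(all_quads_lt n_ge4)/andP[/=].
  case/and5P=> an bn cn dn _; rewrite !inE !negb_or.
  case/and4P=> /and3P[ab _ _] _ cd _.
  by rewrite mdeg_pairing // (lab_inj labK).
- by move=> k l /sub Qk /sub Ql; apply: (quad_dual K labK).
Qed.

Lemma small_complete_graph_splitting : has_minimal_splitting K Kn.
Proof.
have gen1 := quad_gens_deleted (K := K) posK labK pos_lt n_ge4 n_le5.
have gen2 := quad_gens_deleted (K := K) posK' labK' pos_lt' n_ge4 n_le5.
have bin (l : nat -> 'I_n) f : f \in quad_gens K l -> binomial_mpoly f.
  by case/mapP=> k _ ->; do 2!eexists.
exists (deleted_graph lab), (deleted_graph lab').
exists (deleted_subgraph lab), (deleted_subgraph lab'); split.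
  split; [|exact: deleted_proper labK n_ge4|exact: deleted_proper labK' n_ge4].
  move=> f; split=> [/complete_gens/ideal_gen_cat[g [h [Ig Ih ->]]]|].
    by exists g, h; split=> //; [apply/gen1 | apply/gen2].
  case=> g [h [/subgraph_ideal_toric g0 /subgraph_ideal_toric h0 ->]].
  by rewrite /toric_ideal toric_mapD g0 h0 addr0.
exists (quad_gens K lab), (quad_gens K lab'); split.
- split=> [|f]; last exact: bin.
  by apply: quad_gens_minimal gen1; apply: prefix_subseq.
- split=> [|f]; last exact: bin.
  rewrite quad_gens_swap in gen2 *.
  by apply: quad_gens_minimal gen2; apply: suffix_subseq.
have := complete_gens; rewrite quad_gens_cat => gen.
exact: quad_gens_minimal gen.
Qed.

End SmallCompleteGraphs.

Theorem theorem3p12 (K : fieldType) (n : nat) (hn : (4 <= n)%N) :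
  has_minimal_splitting K (complete_graph n) <-> (4 <= n <= 5)%N.
Proof.
split=> [[G1 [G2 [s1 [s2 min12]]]]|/andP[_ n_le5]].
  by rewrite hn leqNgt; apply/negP => n_ge6; apply: no_minimal_splitting min12.
exact: small_complete_graph_splitting.
Qed.
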